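(* Let $\mathbb{K}$ be a field, $s,b\ge1$ integers, and $Z=\mathbb{K}[z_{i,j}:1\le i\le s,\ 1\le j\le b]$. If $J$ is a sparse symmetric shifted ideal in $Z$, then $J$ has linear quotients.
   Context: For $\boldsymbol\mu=(\mu_1,\dots,\mu_s)\in\{0,1,\dots,b\}^s$ put $\boldsymbol z^{\boldsymbol\mu}=\prod_{i=1}^s z_{i,\mu_i}$, with the convention $z_{i,0}=1$; such a monomial is called a sparse squarefree monomial. For two such tuples, $\boldsymbol\mu'\le_0\boldsymbol\mu$ means: $\mu_i'\le\mu_i$ for each $i$, and $\mu_i'=0$ if and only if $\mu_i=0$. The permutation group $\mathfrak{S}_s$ acts on $Z$ by $\mathbb{K}$-algebra automorphisms with $\sigma(z_{i,j})=z_{\sigma(i),j}$. For a monomial ideal $J$, $G(J)$ denotes its set of minimal monomial generators. A squarefree monomial proper ideal $J$ of $Z$ is sparse symmetric shifted if: (S-1) $J$ is generated by sparse squarefree monomials; (S-2) whenever $\boldsymbol z^{\boldsymbol\mu}\in G(J)$ and $\boldsymbol\mu'\le_0\boldsymbol\mu$, then $\boldsymbol z^{\boldsymbol\mu'}\in J$; (S-3) $J$ is invariant under the action of $\mathfrak{S}_s$. A monomial ideal $J$ has linear quotients if its minimal monomial generators can be ordered $u_1,\dots,u_r$ so that for each $i=2,\dots,r$ the colon ideal $\langle u_1,\dots,u_{i-1}\rangle:u_i$ is generated by variables. *)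

(* Defs.v *)
From Stdlib Require Import Classical.
From mathcomp Require Import all_boot all_order all_algebra all_fingroup.
From mathcomp Require Import mpoly.

Set Implicit Arguments.
Unset Strict Implicit.
Unset Printing Implicit Defensive.

Import GRing.Theory.

Local Open Scope ring_scope.

Section Ideals.

Variable A : comNzRingType.
Implicit Types (I S : A -> Prop) (u p : A).

Definition is_ideal I : Prop :=
  I 0 /\ forall a u v : A, I u -> I v -> I (a * u + v).

Definition is_proper_ideal I : Prop := is_ideal I /\ ~ I 1.

Definition ideal_gen S p : Prop :=
  exists2 r : seq (A * A),
    forall x, x \in r -> S x.2 & p = \sum_(x <- r) x.1 * x.2.

Definition generates S I : Prop := forall p, I p <-> ideal_gen S p.

Definition generated_by (P : A -> Prop) I : Prop :=
  exists S : A -> Prop, (forall u, S u -> P u) /\ generates S I.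

Definition colon I u : A -> Prop := fun p => I (p * u).

Definition divides v u : Prop := exists w, u = w * v.

End Ideals.

Section MonomialIdeals.

Variables (K : fieldType) (n : nat).
Implicit Types (J : {mpoly K[n]} -> Prop) (u : {mpoly K[n]}).

Definition is_monomial u : Prop := exists m : 'X_{1..n}, u = 'X_[m].

Definition is_squarefree_monomial u : Prop :=
  exists m : 'X_{1..n}, (forall k : 'I_n, (m k <= 1)%N) /\ u = 'X_[m].

Definition is_variable u : Prop := exists k : 'I_n, u = 'X_k.

Definition is_monomial_ideal J : Prop :=
  is_ideal J /\ generated_by is_monomial J.

Definition is_squarefree_monomial_ideal J : Prop :=
  is_ideal J /\ generated_by is_squarefree_monomial J.

(* The set G(J): the monomials of J that are minimal for divisibility.  For a
   monomial ideal J this is the unique minimal set of monomial generators, see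
   [mingens_generates] and [mingens_least] below. *)
Definition mingens J u : Prop :=
  [/\ is_monomial u, J u &
      forall v, is_monomial v -> J v -> divides v u -> v = u].

(* The list is indexed from 0, so us`_0 is the first generator and the colon
   condition starts at index 1. *)
Definition has_linear_quotients J : Prop :=
  is_monomial_ideal J /\
  exists us : seq {mpoly K[n]},
    [/\ uniq us,
        forall u, u \in us <-> mingens J u &
        forall i : nat, (0 < i < size us)%N ->
          generated_by is_variable
            (colon (ideal_gen (fun v => v \in take i us)) us`_i)].

End MonomialIdeals.

Section MonomialIdealFacts.

Variables (K : fieldType) (n : nat).
Implicit Types (J S : {mpoly K[n]} -> Prop).

Lemma divides_monomial (m1 m2 : 'X_{1..n}) :
  divides ('X_[m1] : {mpoly K[n]}) 'X_[m2] <-> (m1 <= m2)%MM.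
Proof.
split=> [[w /(congr1 (mcoeff m2))]|le12].
  rewrite mcoeffX eqxx => /esym/eqP e.
  have: m2 \in msupp (w * 'X_[m1]) by rewrite mcoeff_msupp (eqP e) oner_eq0.
  by rewrite (perm_mem (msuppMX _ _)) => /mapP[m _ ->]; apply: lem_addr.
by exists 'X_[m2 - m1]; rewrite -mpolyXD submK.
Qed.

Lemma ideal_gen_monomial S (m : 'X_{1..n}) :
  (forall u, S u -> is_monomial u) -> ideal_gen S 'X_[m] ->
  exists2 m' : 'X_{1..n}, S 'X_[m'] & (m' <= m)%MM.
Proof.
move=> Smon [r rS /(congr1 (mcoeff m))]; rewrite mcoeffX eqxx raddf_sum /= => e.
have [/hasP[x xr xm]|/hasPn no] :=
    boolP (has (fun x : {mpoly K[n]} * {mpoly K[n]} => m \in msupp (x.1 * x.2)) r).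
  have [m' em'] := Smon _ (rS _ xr); exists m'; first by rewrite -em'; apply: rS.
  move: xm; rewrite em' (perm_mem (msuppMX _ _)) => /mapP[k _ ->].
  exact: lem_addr.
move: e; rewrite big_seq big1 => [|x /no]; last first.
  by rewrite mcoeff_msupp negbK => /eqP.
by move/eqP; rewrite oner_eq0.
Qed.

Lemma mingens_below J (m : 'X_{1..n}) :
  J 'X_[m] -> exists2 m' : 'X_{1..n}, mingens J 'X_[m'] & (m' <= m)%MM.
Proof.
have [d] := ubnP (mdeg m); elim: d m => // d IHd m le_md Jm.
have [[m' [Jm' le_m' ne_m']]|no] := classic
    (exists m' : 'X_{1..n}, [/\ J 'X_[m'], (m' <= m)%MM & m' <> m]).
  have dlt: (mdeg m' < mdeg m)%N.
    rewrite -(submK le_m') mdegD -[X in (X < _)%N]add0n ltn_add2r lt0n mdeg_eq0.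
    by apply/eqP => e; apply: ne_m'; rewrite -(submK le_m') e add0m.
  have [k mink le_k] := IHd m' (leq_trans dlt le_md) Jm'.
  by exists k => //; apply: lepm_trans le_k le_m'.
exists m; last exact: lepm_refl.
split=> [||_ [k ->] Jk /divides_monomial le_k] //; first by exists m.
by congr ('X_[_]); apply: NNPP => ne; apply: no; exists k.
Qed.

Lemma ideal_gen_sub (A : comNzRingType) (I S : A -> Prop) (p : A) :
  is_ideal I -> (forall u, S u -> I u) -> ideal_gen S p -> I p.
Proof.
move=> [I0 Iadd] SI [r rS ->]; elim: r rS => [|x r IHr] rS.
  by rewrite big_nil.
rewrite big_cons; apply: Iadd; first by apply/SI/rS/mem_head.
by apply: IHr => y yr; apply: rS; rewrite inE yr orbT.
Qed.

Lemma ideal_gen_ideal (A : comNzRingType) (S : A -> Prop) :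
  is_ideal (ideal_gen S).
Proof.
split; first by exists [::]; rewrite ?big_nil.
move=> a _ _ [r rS ->] [t tS ->].
exists ([seq (a * x.1, x.2) | x <- r] ++ t).
  by move=> x; rewrite mem_cat => /orP[/mapP[y yr ->]|/tS //]; apply: rS yr.
rewrite big_cat big_map mulr_sumr; congr (_ + _).
by apply: eq_bigr => x _; rewrite mulrA.
Qed.

Lemma mingens_generates J : is_monomial_ideal J -> generates (mingens J) J.
Proof.
move=> [idJ [S [Smon genS]]] p; split; last first.
  by apply: ideal_gen_sub => // u [].
move/genS; apply: ideal_gen_sub; first exact: ideal_gen_ideal.
move=> u Su; have [m em] := Smon _ Su.
have Ju: J 'X_[m].
  apply/genS; exists [:: (1, 'X_[m])]; last by rewrite big_seq1 mul1r.
  by move=> x; rewrite inE => /eqP -> /=; rewrite -em.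
have [k mink le_k] := mingens_below Ju.
exists [:: ('X_[m - k], 'X_[k])].
  by move=> x; rewrite inE => /eqP ->.
by rewrite big_seq1 /= -mpolyXD submK.
Qed.

Lemma mingens_least J S :
  (forall u, S u -> is_monomial u) -> generates S J ->
  forall u, mingens J u -> S u.
Proof.
move=> Smon genS _ [[m ->] Jm minm].
have [k Sk le_k] := ideal_gen_monomial Smon (proj1 (genS _) Jm).
rewrite -(minm 'X_[k]) //; first by exists k.
  apply/genS; exists [:: (1, 'X_[k])]; last by rewrite big_seq1 mul1r.
  by move=> x; rewrite inE => /eqP ->.
exact/divides_monomial.
Qed.

End MonomialIdealFacts.

Section SparseSymmetricShifted.

Variables (K : fieldType) (s b : nat).

(* Z = K[z_(i,j)], with the s * b variables numbered through [mxvec_index].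
   Both indices are shifted to start at 0: i : 'I_s and j : 'I_b. *)
Notation Z := {mpoly K[s * b]}.

Definition zvar (i : 'I_s) (j : 'I_b) : Z := 'X_(mxvec_index i j).

(* Exponent tuples take values in {0, ..., b}: the value 0 contributes the
   factor 1, and the value j.+1 the j-th variable of row i, that is z_(i,j.+1)
   in 1-based numbering. *)
Definition zvar0 (i : 'I_s) (j : 'I_b.+1) : Z :=
  if unlift ord0 j is Some j' then zvar i j' else 1.

Definition sparse_monomial (mu : {ffun 'I_s -> 'I_b.+1}) : Z :=
  \prod_(i < s) zvar0 i (mu i).

Definition is_sparse_squarefree (u : Z) : Prop :=
  exists mu : {ffun 'I_s -> 'I_b.+1}, u = sparse_monomial mu.

Definition le0 (mu' mu : {ffun 'I_s -> 'I_b.+1}) : Prop :=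
  forall i : 'I_s, (mu' i <= mu i)%N /\ (mu' i = ord0 <-> mu i = ord0).

(* Substitution z_(i,j) |-> z_(sigma i,j), see [sym_act_zvar]. *)
Definition sym_act (sigma : 'S_s) (p : Z) : Z :=
  p \mPo [tuple mxvec (\matrix_(i < s, j < b) zvar (sigma i) j) 0 k | k < s * b].

Lemma sym_act_zvar (sigma : 'S_s) (i : 'I_s) (j : 'I_b) :
  sym_act sigma (zvar i j) = zvar (sigma i) j.
Proof. by rewrite /sym_act comp_mpolyXU -tnth_nth tnth_mktuple mxvecE mxE. Qed.

Record sparse_symmetric_shifted (J : Z -> Prop) : Prop := {
  sss_proper : is_proper_ideal J;
  sss_squarefree : is_squarefree_monomial_ideal J;
  sss_S1 : generated_by is_sparse_squarefree J;
  sss_S2 : forall mu mu' : {ffun 'I_s -> 'I_b.+1},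
    mingens J (sparse_monomial mu) -> le0 mu' mu -> J (sparse_monomial mu');
  sss_S3 : forall (sigma : 'S_s) (p : Z), J p -> J (sym_act sigma p)
}.

End SparseSymmetricShifted.

(* Main.v *)
(** Encode a sparse monomial by its tuple [mu] and list the minimal generators
    by increasing [key mu], the sum of [s * mu_i + i] over the support of [mu],
    ties being broken arbitrarily.  Let [nu <> mu] be generators with
    [key nu <= key mu].  If [0 < nu_i < mu_i] for some [i], lowering [mu_i] to
    [nu_i] stays in [J].  If [mu_i = 0 < nu_i] and some [mu_k <> 0] has
    [s * nu_i + i < s * mu_k + k], then [nu_i <= mu_k], so by symmetry and
    shifting one may replace the entry [mu_k] at [k] by [nu_i] at [i].  Either
    way a generator of strictly smaller key divides the result, which gives the
    variable [z_(i, nu_i)] in the colon ideal.  If neither applies, moving the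
    entries of [nu] outside the support of [mu] into it shows [nu = mu]. *)

From Stdlib Require Import Classical.
Require Import Defs.
From mathcomp Require Import all_boot all_order all_algebra.
From mathcomp Require Import all_fingroup.
From mathcomp Require Import mpoly zify.

Set Implicit Arguments.
Unset Strict Implicit.
Unset Printing Implicit Defensive.

Import GRing.Theory.

Local Open Scope ring_scope.

(** * Combinatorics of shifted and symmetric sets of tuples *)

Section ShiftedTuples.

Variables (s b : nat).
Notation T := {ffun 'I_s -> 'I_b.+1}.
Implicit Types (mu nu tau w : T) (i k : 'I_s) (v : 'I_b.+1).

(** Since [i < s], this orders pairs with nonzero value lexicographically, by value first and by row
    second. *)
Definition cost i v : nat := if v == ord0 then 0%N else (s * v + i)%N.

Definition key mu : nat := (\sum_i cost i (mu i))%N.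

Definition upd mu i v : T := [ffun k => if k == i then v else mu k].

(** Divisibility of the encoded sparse monomials, see [sparse_mnm_le]. *)
Definition dvt tau mu : Prop := forall i, tau i = ord0 \/ tau i = mu i.

Lemma cost_lt i v v' : (v < v')%N -> (cost i v < cost i v')%N.
Proof.
move=> lt_vv; rewrite /cost -!val_eqE /=; have := ltn_ord i.
by case: eqP => ?; case: eqP => ?; nia.
Qed.

Lemma cost_le i v v' : (v <= v')%N -> (cost i v <= cost i v')%N.
Proof.
by rewrite leq_eqVlt => /orP[/eqP/val_inj -> //|/(cost_lt i)/ltnW].
Qed.

Lemma cost_le_val i k v v' :
  v' != ord0 -> (cost k v' <= cost i v)%N -> (v' <= v)%N.
Proof.
move=> v'0; apply: contraTT; rewrite -!ltnNge => lt_v.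
rewrite /cost (negPf v'0); have := ltn_ord i; have := leq_mul (leqnn s) lt_v.
by case: eqP => _; lia.
Qed.

(** Reduction modulo [s] recovers the row from the cost of a nonzero value. *)
Lemma cost_neq i k v v' :
  i != k -> v != ord0 -> v' != ord0 -> cost i v != cost k v'.
Proof.
rewrite /cost => ne_ik /negPf -> /negPf ->; apply: contraNneq ne_ik => /(congr1 (modn^~ s)).
by rewrite ![(s * _)%N]mulnC !modnMDl !modn_small // => /val_inj ->.
Qed.

Lemma key_lt mu nu : (forall i, mu i <= nu i)%N -> mu <> nu ->
  (key mu < key nu)%N.
Proof.
move=> le_mn ne_mn; have [i ne_i]: exists i, mu i != nu i.
  apply/existsP; apply: contra_notT ne_mn; rewrite negb_exists => /forallP e.
  by apply/ffunP => i; apply/eqP; rewrite -[_ == _]negbK e.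
rewrite /key (bigD1 i) // [X in (_ < X)%N](bigD1 i) //= -addSn leq_add //.
  by apply: cost_lt; rewrite ltn_neqAle val_eqE ne_i le_mn.
by apply: leq_sum => k _; apply: cost_le.
Qed.

Lemma key_upd mu i v : (key (upd mu i v) + cost i (mu i) = key mu + cost i v)%N.
Proof.
rewrite /key (bigD1 i) // [in RHS](bigD1 i) //= ffunE eqxx.
have -> : (\sum_(k | k != i) cost k (upd mu i v k)
           = \sum_(k | k != i) cost k (mu k))%N.
  by apply: eq_bigr => k /negPf ne_k; rewrite ffunE ne_k.
by rewrite addnC (addnC (cost i v)) addnA.
Qed.

Lemma dvt_le tau mu : dvt tau mu -> forall i, (tau i <= mu i)%N.
Proof. by move=> d i; case: (d i) => ->. Qed.

Variable L : T -> Prop.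

Definition minimal mu : Prop :=
  L mu /\ forall tau, L tau -> dvt tau mu -> tau = mu.

(** Descent on [key], which drops strictly on proper divisors by [key_lt]. *)
Lemma minimal_below mu : L mu -> exists2 tau, minimal tau & dvt tau mu.
Proof.
have [d] := ubnP (key mu); elim: d mu => // d IHd mu le_d Lmu.
have [[tau [Lt dt ne]]|no] :=
    classic (exists tau, [/\ L tau, dvt tau mu & tau <> mu]).
  have lt_k := key_lt (dvt_le dt) ne.
  have [w mw dw] := IHd tau (leq_trans lt_k le_d) Lt.
  exists w => // i; case: (dw i) => ->; first by left.
  exact: dt.
exists mu; last by right.
by split=> // tau Lt dt; apply: NNPP => ne; apply: no; exists tau.
Qed.

Hypothesis L_shift : forall mu mu', L mu -> le0 mu' mu -> L mu'.
Hypothesis L_perm : forall (sigma : 'S_s) mu, L mu ->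
  L [ffun i => mu (sigma i)].

Lemma shift1 mu i v : L mu -> v != ord0 -> (v <= mu i)%N -> L (upd mu i v).
Proof.
move=> Lmu v0 le_v; apply: L_shift Lmu _ => k; rewrite ffunE.
case: eqP => [-> |] //; split=> //; split=> e; first by rewrite e eqxx in v0.
by move: le_v v0; rewrite e leqn0 -val_eqE => ->.
Qed.

(** Lower the entry at [k] to [v], then transpose rows [i] and [k]. *)
Lemma exchange mu i k v : L mu -> i != k -> mu i = ord0 -> v != ord0 ->
  (v <= mu k)%N -> L (upd (upd mu k ord0) i v).
Proof.
move=> Lmu ne_ik mui v0 le_v.
have := L_perm (tperm i k) (shift1 Lmu v0 le_v); congr L.
apply/ffunP => j; rewrite !ffunE.
case: tpermP => [->|->|/eqP/negPf ji /eqP/negPf jk].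
- by rewrite !eqxx.
- by rewrite eqxx (negPf ne_ik) eq_sym (negPf ne_ik).
- by rewrite ji jk.
Qed.

Lemma key_exchange mu i k v : i != k -> mu i = ord0 ->
  (key (upd (upd mu k ord0) i v) + cost k (mu k) = key mu + cost i v)%N.
Proof.
move=> ne_ik mui; have := key_upd (upd mu k ord0) i v; have := key_upd mu k ord0.
by rewrite ffunE (negPf ne_ik) mui /cost eqxx; lia.
Qed.

(* The conditions on [nu] say that no coordinate of [nu] improves [mu].
   Trading a coordinate of [nu] outside the support of [mu] for one inside it
   stays in [L], preserves them and lowers the key. *)
Lemma unimprovable_eq mu nu :
  minimal mu -> L nu -> (key nu <= key mu)%N ->
  (forall i, nu i != ord0 -> mu i != ord0 -> (mu i <= nu i)%N) ->
  (forall i k, nu i != ord0 -> mu i = ord0 -> mu k != ord0 ->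
     (cost k (mu k) <= cost i (nu i))%N) ->
  nu = mu.
Proof.
move=> [Lmu min_mu]; have [d] := ubnP (key nu); elim: d nu => // d IHd nu le_d.
move=> Lnu le_key H1 H2.
case: (pickP (fun a => (mu a == ord0) && (nu a != ord0))) =>
    [a /andP[/eqP mua nua]|A0].
  case: (pickP (fun k => (mu k != ord0) && (nu k == ord0))) =>
      [k /andP[muk /eqP nuk]|C0].
    have ne_ka : k != a by apply: contraNneq muk => ->; rewrite mua.
    have le_c := H2 a k nua mua muk.
    have lt_c : (cost k (mu k) < cost a (nu a))%N.
      by rewrite ltn_neqAle le_c cost_neq.
    set nu' := upd (upd nu a ord0) k (mu k).
    have Lnu' : L nu' by apply: exchange => //; apply: cost_le_val le_c.
    have lt_key : (key nu' < key nu)%N.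
      by have := key_exchange (mu k) ne_ka nuk; rewrite -/nu'; lia.
    (* The induction hypothesis would give [nu' = mu], hence [key mu < key nu], which is absurd. *)
    suff e : nu' = mu by move: lt_key; rewrite e ltnNge le_key.
    apply: IHd => //; first exact: leq_trans lt_key le_d.
    - exact: leq_trans (ltnW lt_key) le_key.
    - move=> i; rewrite !ffunE; case: (i =P k) => [-> //|_].
      by case: (i =P a) => [_|_]; [rewrite eqxx | apply: H1].
    - move=> i j; rewrite !ffunE; case: (i =P k) => [-> _ e|_].
        by rewrite e eqxx in muk.
      by case: (i =P a) => [_|_]; [rewrite eqxx | apply: H2].
  (* The support of [mu] now lies in that of [nu], strictly because of [a], so [nu] would have the
     larger key. *)
  have le_mn i : (mu i <= nu i)%N.
    have := C0 i; have := H1 i; have [-> //|_ H /= /negbT nui] := eqVneq (mu i) ord0.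
    exact: H.
  have ne : mu <> nu by move=> e; rewrite -e mua eqxx in nua.
  by have := key_lt le_mn ne; rewrite ltnNge le_key.
(* Now the support of [nu] lies in that of [mu]. Restricting [mu] to it gives a tuple that [L_shift]
   obtains from [nu]; minimality of [mu] then forces equal supports. *)
pose tau : T := [ffun i => if nu i == ord0 then ord0 else mu i].
have A0' i : nu i != ord0 -> mu i != ord0.
  by move=> nui; have := A0 i; rewrite /= nui andbT => ->.
have Ltau : L tau.
  apply: L_shift Lnu _ => i; rewrite ffunE.
  case: (eqVneq (nu i) ord0) => [-> //|nui]; split; first exact/H1/A0'.
  by split=> [e|e]; [move: (A0' i nui); rewrite e | move: nui; rewrite e].
have dtau : dvt tau mu by move=> i; rewrite ffunE; case: eqP; [left | right].
have e_tau := min_mu _ Ltau dtau.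
have le_mn i : (mu i <= nu i)%N.
  rewrite -e_tau ffunE; case: (eqVneq (nu i) ord0) => // nui.
  exact/H1/A0'.
apply: NNPP => ne; have := key_lt le_mn (fun e => ne (esym e)).
by rewrite ltnNge le_key.
Qed.

(** The variable $z_{i,\nu_i}$ divides $z^\nu$ but not $z^\mu$, and $z^w$ divides $z^\mu
    z_{i,\nu_i}$, as [upd] at most drops the old entry of row [i]. This is the input of
    [colon_generated_by_variables]. *)
Lemma linear_step mu nu :
  minimal mu -> minimal nu -> (key nu <= key mu)%N -> nu <> mu ->
  exists i w, [/\ minimal w, (key w < key mu)%N, nu i != ord0, nu i != mu i &
                  dvt w (upd mu i (nu i))].
Proof.
move=> min_mu [Lnu _] le_key ne.
have [[i [nui mui lt_i]]|no1] := classic (exists i,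
    [/\ nu i != ord0, mu i != ord0 & (nu i < mu i)%N]).
  have [w min_w dw] := minimal_below (shift1 (proj1 min_mu) nui (ltnW lt_i)).
  have ne_i : nu i != mu i by rewrite -val_eqE neq_ltn lt_i.
  exists i, w; split=> //; apply: key_lt => [k|e].
    apply: leq_trans (dvt_le dw k) _; rewrite ffunE.
    by case: eqP => [->|]; first exact: ltnW.
  by have := dvt_le dw i; rewrite ffunE eqxx e leqNgt lt_i.
have [[i [k [nui mui muk lt_c]]]|no2] := classic (exists i k,
    [/\ nu i != ord0, mu i = ord0, mu k != ord0 &
        (cost i (nu i) < cost k (mu k))%N]).
  have ne_ik : i != k by apply: contraNneq muk => <-; rewrite mui.
  have le_v := cost_le_val nui (ltnW lt_c).
  have [w min_w dw] := minimal_below (exchange (proj1 min_mu) ne_ik mui nui le_v).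
  exists i, w; split=> //; first last.
  - move=> j; case: (dw j) => ->; first by left.
    rewrite !ffunE; case: eqP => _; first by right.
    by case: eqP => _; [left | right].
  - by rewrite mui.
  (* The exchange lowers the key by [cost k (mu k) - cost i (nu i)], and passing to the divisor [w]
     cannot raise it. *)
  have := key_exchange (nu i) ne_ik mui.
  have [<-|/eqP ne_w] := eqVneq w (upd (upd mu k ord0) i (nu i)); first lia.
  by have := key_lt (dvt_le dw) ne_w; lia.
case: ne; apply: unimprovable_eq => // [i nui mui|i k nui mui muk].
  by rewrite leqNgt; apply/negP => lt_i; apply: no1; exists i.
by rewrite leqNgt; apply/negP => lt_c; apply: no2; exists i, k.
Qed.

End ShiftedTuples.

(** * Monomial ideals and their colon ideals *)

Section MonomialIdealLemmas.

Variables (K : fieldType) (n : nat).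
Implicit Types (S : {mpoly K[n]} -> Prop) (m : 'X_{1..n}) (p : {mpoly K[n]}).

Lemma ideal_gen_mem (A : comNzRingType) (S : A -> Prop) (u : A) :
  S u -> ideal_gen S u.
Proof.
move=> Su; exists [:: (1, u)]; last by rewrite big_seq1 mul1r.
by move=> x; rewrite inE => /eqP ->.
Qed.

Lemma is_ideal_colon (A : comNzRingType) (I : A -> Prop) (u : A) :
  is_ideal I -> is_ideal (colon I u).
Proof.
move=> [I0 Iadd]; split; first by rewrite /colon mul0r.
by move=> a x y Ix Iy; rewrite /colon mulrDl -mulrA; apply: Iadd.
Qed.

Lemma mpolyX_inj : injective (fun m => 'X_[m] : {mpoly K[n]}).
Proof.
move=> m m' /(congr1 (mcoeff m')); rewrite !mcoeffX eqxx.
by case: eqP => // _ /esym/eqP; rewrite oner_eq0.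
Qed.

(** Some summand must contribute [m], and every monomial of a multiple of $X^{m'}$ is divisible by
    $X^{m'}$. *)
Lemma ideal_gen_msupp S p m :
  (forall u, S u -> is_monomial u) -> ideal_gen S p -> m \in msupp p ->
  exists2 m', S 'X_[m'] & (m' <= m)%MM.
Proof.
move=> Smon [r rS ->] mp.
have [/hasP[x xr xm]|/hasPn no] :=
    boolP (has (fun x : {mpoly K[n]} * {mpoly K[n]} => m \in msupp (x.1 * x.2)) r).
  have [m' em'] := Smon _ (rS _ xr); exists m'; first by rewrite -em'; apply: rS.
  move: xm; rewrite em' (perm_mem (msuppMX _ _)) => /mapP[k _ ->].
  exact: lem_addr.
move: mp; rewrite mcoeff_msupp raddf_sum /= big_seq big1 ?eqxx // => x /no.
by rewrite mcoeff_msupp negbK => /eqP.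
Qed.

Lemma is_ideal_mpoly (I : {mpoly K[n]} -> Prop) p :
  is_ideal I -> (forall m, m \in msupp p -> I 'X_[m]) -> I p.
Proof.
move=> [I0 Iadd] Im; rewrite (mpolyE p) big_seq.
elim/big_ind: _ => // [x y Ix Iy|m mp]; first by rewrite -[x]mul1r; apply: Iadd.
by rewrite -mul_mpolyC -[_ * _]addr0; apply: Iadd => //; apply: Im.
Qed.

Lemma colon_generated_by_variables S m :
  (forall u, S u -> is_monomial u) ->
  (forall m', S 'X_[m'] -> exists k : 'I_n, (m k < m' k)%N /\
     exists2 w, S 'X_[w] & (w <= m + U_(k))%MM) ->
  generated_by (@is_variable K n) (colon (ideal_gen S) 'X_[m]).
Proof.
move=> Smon lin.
have idI : is_ideal (ideal_gen S) by apply: ideal_gen_ideal.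
exists (fun u => is_variable u /\ colon (ideal_gen S) 'X_[m] u).
split=> [u [] //|p]; split; last first.
  by apply: ideal_gen_sub; [apply: is_ideal_colon | move=> u []].
move=> Ip; apply: is_ideal_mpoly => [|q qp]; first exact: ideal_gen_ideal.
have /(ideal_gen_msupp Smon Ip)[m' Sm' le_m'] : (m + q)%MM \in msupp (p * 'X_[m]).
  by rewrite (perm_mem (msuppMX _ _)) map_f.
have [k [lt_k [w Sw le_w]]] := lin m' Sm'.
(* From [m k < m' k <= m k + q k] it follows that [q k] is positive. *)
have le_kq : (U_(k) <= q)%MM.
  rewrite lep1mP; have /mnm_lepP/(_ k) := le_m'; rewrite mnmDE.
  by move: lt_k; case: (q k) => // ; rewrite addn0 ltnNge => /negP.
exists [:: ('X_[q - U_(k)], 'X_k)]; last by rewrite big_seq1 /= -mpolyXD submK.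
move=> x; rewrite inE => /eqP -> /=; split; first by exists k.
rewrite /colon -mpolyXD addmC -(submK le_w) mpolyXD -[_ * _]addr0.
by apply: (proj2 idI); [apply: ideal_gen_mem | apply: (proj1 idI)].
Qed.

End MonomialIdealLemmas.

(** * Exponent vectors of sparse monomials *)

Section SparseMonomials.

Variables (K : fieldType) (s b : nat).
Notation T := {ffun 'I_s -> 'I_b.+1}.
Implicit Types (mu nu tau : T).

Lemma mxvec_index_eq (i i' : 'I_s) (j j' : 'I_b) :
  (mxvec_index i j == mxvec_index i' j') = (i == i') && (j == j').
Proof. by rewrite (inj_eq (@cast_ord_inj _ _ _)) (inj_eq enum_rank_inj). Qed.

Definition sparse_mnm mu : 'X_{1..s * b} :=
  [multinom mxvec (\matrix_(i < s, j < b) nat_of_bool (mu i == lift ord0 j)) ord0 k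
   | k < s * b].

Lemma sparse_mnmE mu i j :
  sparse_mnm mu (mxvec_index i j) = (mu i == lift ord0 j).
Proof. by rewrite mnmE mxvecE mxE. Qed.

Lemma sparse_monomialE mu : sparse_monomial K mu = 'X_[sparse_mnm mu].
Proof.
pose f i : 'X_{1..s * b} :=
  if unlift ord0 (mu i) is Some j then U_(mxvec_index i j)%MM else 0%MM.
have -> : sparse_monomial K mu = \prod_i 'X_[f i].
  by apply: eq_bigr => i _; rewrite /zvar0 /f; case: unlift => //; rewrite mpolyX0.
rewrite mprodXE; congr ('X_[_]); apply/mnmP => k.
case/mxvec_indexP: k => i j; rewrite sparse_mnmE mnm_sumE.
have fE i' : f i' (mxvec_index i j) = (i' == i) && (mu i' == lift ord0 j) :> nat.
  rewrite /f; case: unliftP => [j' ->|->]; last by rewrite mnm0E andbF.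
  by rewrite mnm1E mxvec_index_eq (inj_eq lift_inj).
rewrite (bigD1 i) //= fE eqxx /= big1 ?addn0 // => i' /negPf ne_i.
by rewrite fE ne_i.
Qed.

(** Each row carries at most one variable, so divisibility is decided row by row. *)
Lemma sparse_mnm_le tau mu : (sparse_mnm tau <= sparse_mnm mu)%MM <-> dvt tau mu.
Proof.
split=> [/mnm_lepP le_tm i|d].
  case: (unliftP ord0 (tau i)) => [j e|]; last by left.
  right; have := le_tm (mxvec_index i j); rewrite !sparse_mnmE e eqxx.
  by case: eqP.
apply/mnm_lepP => k; case/mxvec_indexP: k => i j; rewrite !sparse_mnmE.
by case: (d i) => ->.
Qed.

Lemma dvt_anti tau mu : dvt tau mu -> dvt mu tau -> tau = mu.
Proof.
by move=> d1 d2; apply/ffunP => i; case: (d1 i) (d2 i) => [-> [->|]|].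
Qed.

Lemma sparse_monomial_inj : injective (@sparse_monomial K s b).
Proof.
move=> tau mu; rewrite !sparse_monomialE => /mpolyX_inj e.
by apply: dvt_anti; apply/sparse_mnm_le; rewrite e; apply: lepm_refl.
Qed.

(** The entry of row [i] moves to row [sigma i], whence the inverse. *)
Lemma sym_act_sparse (sigma : 'S_s) mu :
  sym_act sigma (sparse_monomial K mu)
  = sparse_monomial K [ffun i => mu ((sigma^-1)%g i)].
Proof.
rewrite /sparse_monomial {1}/sym_act rmorph_prod /=.
rewrite [RHS](reindex_inj (@perm_inj _ sigma)) /=; apply: eq_bigr => i _.
rewrite ffunE permK /zvar0; case: unlift => [j|]; last by rewrite rmorph1.
exact: (@sym_act_zvar K).
Qed.

End SparseMonomials.

(** As [P] is an arbitrary proposition, membership is decided classically, one element at a time. *)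
Lemma finite_subset_seq (T : finType) (P : T -> Prop) :
  exists2 r : seq T, uniq r & forall x, x \in r <-> P x.
Proof.
suff [r rP] : exists r : seq T, forall x, x \in r <-> x \in enum T /\ P x.
  exists (undup r); first exact: undup_uniq.
  by move=> x; rewrite mem_undup rP mem_enum; split=> [[]|].
elim: (enum T) => [|y t [r rP]]; first by exists [::] => x; split=> [|[]].
have [Py|nPy] := classic (P y); [exists (y :: r) | exists r] => x;
  rewrite !inE; split.
- by case/orP => [/eqP -> | /rP[-> Px]]; rewrite ?eqxx ?orbT.
- by case=> /orP[-> //|xt Px]; apply/orP; right; apply/rP.
- by case/rP => -> Px; rewrite orbT.
- by case=> /orP[/eqP -> /nPy //|xt Px]; apply/rP.
Qed.

Theorem theorem2p6 (K : fieldType) (s b : nat) (hs : (1 <= s)%N) (hb : (1 <= b)%N)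
    (J : {mpoly K[s * b]} -> Prop) (hJ : sparse_symmetric_shifted J) :
  has_linear_quotients J.
Proof.
have [[idJ _] [_ [S0 [S0sf genS0]]] [S [Ssp genS]] S2 S3] := hJ.
have monJ : is_monomial_ideal J.
  by split=> //; exists S0; split=> // u /S0sf[m [_ ->]]; exists m.
pose L (mu : {ffun 'I_s -> 'I_b.+1}) := J (sparse_monomial K mu).
have gens_sparse u : mingens J u -> exists mu, u = sparse_monomial K mu.
  move/(mingens_least _ genS) => Su; apply/Ssp/Su => v /Ssp[mu ->].
  by exists (sparse_mnm mu); apply: sparse_monomialE.
have gens_below m : J 'X_[m] -> exists2 mu,
    mingens J (sparse_monomial K mu) & (sparse_mnm mu <= m)%MM.
  case/mingens_below => m' min_m' le_m'; have [mu e] := gens_sparse _ min_m'.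
  exists mu; first by rewrite -e.
  by move: e; rewrite sparse_monomialE => /mpolyX_inj <-.
(* (S-2) speaks of minimal generators only. For a generator [tau] dividing [mu], the restriction
   [tau'] of [mu'] to the support of [tau] satisfies [le0 tau' tau] and divides [mu']. *)
have L_shift mu mu' : L mu -> le0 mu' mu -> L mu'.
  rewrite /L [in X in X -> _]sparse_monomialE => /gens_below[tau min_tau].
  move/sparse_mnm_le => d le_mu.
  pose tau' : {ffun 'I_s -> 'I_b.+1} :=
    [ffun i => if tau i == ord0 then ord0 else mu' i].
  have Jt : J (sparse_monomial K tau').
    apply: S2 min_tau _ => i; rewrite ffunE; case: eqP => [-> //|nz].
    by case: (d i) => // ->.
  have : (sparse_mnm tau' <= sparse_mnm mu')%MM.
    by apply/sparse_mnm_le => i; rewrite ffunE; case: eqP; [left | right].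
  move/submK; rewrite sparse_monomialE => <-; rewrite mpolyXD -[_ * _]addr0.
  by apply: (proj2 idJ); rewrite -?sparse_monomialE //; apply: (proj1 idJ).
have L_perm (sigma : 'S_s) mu : L mu -> L [ffun i => mu (sigma i)].
  by move/(S3 (sigma^-1)%g); rewrite sym_act_sparse invgK.
have minE mu : mingens J (sparse_monomial K mu) <-> minimal L mu.
  split=> [[_ Jmu min_mu]|[Lmu min_mu]].
    split=> // tau Lt d; apply: (@sparse_monomial_inj K); apply: min_mu => //.
      by exists (sparse_mnm tau); apply: sparse_monomialE.
    by rewrite !sparse_monomialE; apply/divides_monomial/sparse_mnm_le.
  split=> //; first by exists (sparse_mnm mu); apply: sparse_monomialE.
  move=> _ [m ->] Jm; rewrite sparse_monomialE => /divides_monomial le_m.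
  (* An arbitrary monomial [m] of [J] dividing [mu] is squeezed between a sparse generator [tau] and
     [mu], which coincide. *)
  have [tau [_ Jt _] le_t] := gens_below m Jm.
  have e : tau = mu by apply: min_mu => //; apply/sparse_mnm_le/(lepm_trans le_t).
  congr ('X_[_]); apply/mnmP => k; apply/eqP; rewrite eqn_leq.
  by rewrite (mnm_lepP le_m) -e (mnm_lepP le_t).
have [r uniq_r rP] := finite_subset_seq (minimal L).
pose le_key : rel {ffun 'I_s -> 'I_b.+1} := fun mu nu => (key mu <= key nu)%N.
have tot_key : total le_key by move=> ? ?; apply: leq_total.
have tr_key : transitive le_key by move=> ? ? ?; apply: leq_trans.
pose ms := sort le_key r.
have msP mu : mu \in ms <-> minimal L mu by rewrite mem_sort.
have uniq_ms : uniq ms by rewrite sort_uniq.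
have sorted_ms : sorted le_key ms by apply: sort_sorted.
split=> //; exists (map (@sparse_monomial K s b) ms); split.
- by rewrite map_inj_uniq //; apply: sparse_monomial_inj.
- move=> u; split=> [/mapP[mu /msP/minE min_mu -> //]|min_u].
  have [mu e] := gens_sparse u min_u; rewrite e map_f //.
  by apply/msP/minE; rewrite -e.
rewrite size_map => i /andP[_ lt_i].
pose mu0 : {ffun 'I_s -> 'I_b.+1} := [ffun=> ord0].
rewrite (nth_map mu0) // -map_take; set mu := nth mu0 ms i.
have min_mu : minimal L mu by apply/msP/mem_nth.
have mem_takeE tau : tau \in take i ms <-> exists2 j, (j < i)%N & tau = nth mu0 ms j.
  split=> [/(nthP mu0)[j]|[j lt_j ->]].
    rewrite size_take lt_i => lt_j <-; exists j => //; exact: nth_take.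
  by rewrite -(nth_take mu0 lt_j) mem_nth // size_take lt_i.
rewrite sparse_monomialE; apply: colon_generated_by_variables.
  by move=> u /mapP[tau _ ->]; exists (sparse_mnm tau); apply: sparse_monomialE.
move=> m' /mapP[nu nu_t]; rewrite sparse_monomialE => /mpolyX_inj ->{m'}.
have [j lt_j e_nu] := (proj1 (mem_takeE nu) nu_t).
have lt_jm := ltn_trans lt_j lt_i.
have min_nu : minimal L nu by apply/msP; rewrite e_nu mem_nth.
have le_nu : (key nu <= key mu)%N.
  by rewrite e_nu; apply: (sorted_ltn_nth tr_key mu0 sorted_ms).
have ne_nu : nu <> mu.
  rewrite e_nu => /eqP; rewrite nth_uniq // => /eqP e.
  by rewrite e ltnn in lt_j.
have [a [w [min_w lt_w nua ne_a dw]]] :=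
  linear_step L_shift L_perm min_mu min_nu le_nu ne_nu.
have [c e_c] : exists c, nu a = lift ord0 c.
  by case: (unliftP ord0 (nu a)) nua => [c ->|->] //; exists c.
exists (mxvec_index a c); rewrite !sparse_mnmE -e_c eqxx eq_sym (negPf ne_a).
split=> //; exists (sparse_mnm w).
  rewrite -sparse_monomialE map_f //; apply/mem_takeE.
  have /(nthP mu0)[l lt_l e_w] := proj2 (msP w) min_w; exists l => //.
  (* A position at or after [i] would give [key mu <= key w], since [ms] is sorted. *)
  rewrite ltnNge; apply/negP; rewrite leq_eqVlt => /orP[/eqP e|lt_il].
    by move: lt_w; rewrite -e_w -e ltnn.
  move: lt_w; rewrite ltnNge -e_w => /negP; apply.
  exact: (sorted_ltn_nth tr_key mu0 sorted_ms).
apply/mnm_lepP => k; case/mxvec_indexP: k => i' j'.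
rewrite mnmDE mnm1E !sparse_mnmE.
(* In row [a] the entry of [upd] is covered by the added variable; in the other rows it is that of
   [mu]. *)
case: (dw i') => -> //; rewrite ffunE; case: (i' =P a) => [->|_]; last exact: leq_addr.
rewrite e_c (inj_eq lift_inj); case: (eqVneq c j') => [->|] //.
by rewrite eqxx addn1.
Qed.
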